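(* Let $\mathbf{A}$ be an algebra such that $\mathbf{M}_3$, with atoms $\alpha,\beta,\gamma$, is a sublattice of $\operatorname{Con}(\mathbf{A})$ consisting of pairwise permuting congruences, and let $\delta$ denote the top of this $\mathbf{M}_3$. Then there is an algebra $\mathbf{A}(\gamma)\in\mathbf{SP}(\mathbf{A})$ such that the sublattice of $\operatorname{Con}(\mathbf{A}(\gamma))$ with universe $$\{0_{\operatorname{Con}(\mathbf{A}(\gamma))},\ \eta_0,\ \alpha_0\wedge\alpha_1,\ \alpha_0\wedge\beta_1,\ \alpha_0,\ \beta_0,\ \gamma_0,\ \delta_0\}$$ is isomorphic to $\mathbf{M}_{3,3}$, where $0_{\operatorname{Con}(\mathbf{A}(\gamma))}$ corresponds to the bottom, $\alpha_0\wedge\alpha_1$, $\alpha_0\wedge\beta_1$, $\eta_0$ to the three atoms, $\alpha_0,\beta_0,\gamma_0$ to the three elements covering the atom $\eta_0$ (with $\alpha_0$ also covering the two other atoms), and $\delta_0$ to the top; and this sublattice has pairwise permuting congruences.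
   Context: Algebras are in the sense of universal algebra; $\operatorname{Con}(\mathbf{A})$ is the congruence lattice of $\mathbf{A}$, $0_{\operatorname{Con}(\mathbf{A}(\gamma))}$ is the least element of $\operatorname{Con}(\mathbf{A}(\gamma))$, i.e. the identity congruence of $\mathbf{A}(\gamma)$, and $\mathbf{SP}(\mathbf{A})$ is the class of subalgebras of powers of $\mathbf{A}$. Two congruences $\lambda,\mu$ permute if $\lambda\circ\mu=\mu\circ\lambda$. $\mathbf{M}_3$ is the five-element lattice with a bottom, a top and three pairwise incomparable atoms, any two distinct atoms meeting to the bottom and joining to the top. $\mathbf{A}(\gamma)$ is the subalgebra of $\mathbf{A}^2$ with universe $\{(a_0,a_1)\in A^2 : (a_0,a_1)\in\gamma\}$. For $\theta\in\operatorname{Con}(\mathbf{A})$ and $i\in\{0,1\}$, $\theta_i=\{((a_0,a_1),(b_0,b_1)) : (a_i,b_i)\in\theta\}\in\operatorname{Con}(\mathbf{A}(\gamma))$, and $\eta_i$ is the kernel of the projection of $\mathbf{A}(\gamma)$ onto the $i$-th coordinate. $\mathbf{M}_{3,3}$ is the 8-element lattice with elements $0,x,y,z,a,b,c,1$ and covering relations $0\prec x,y,z$; $x,y,z\prec a$; $z\prec b,c$; $a,b,c\prec 1$ (two copies of $\mathbf{M}_3$ glued along an edge).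
   Formalization: The bottom of the sublattice M_3 is additionally assumed to be the identity congruence of A; otherwise, for a ≠ b with (a,b) in α∧γ, the pair ((a,a),(a,b)) lies in η_0∧α_0∧α_1, so these atoms do not meet to 0 (e.g. A = Z_2^3). *)

(* Defs.v *)
From HB Require Import structures.
From mathcomp Require Import all_boot all_order.
From mathcomp Require Import boolp classical_sets.

Set Implicit Arguments.
Unset Strict Implicit.
Unset Printing Implicit Defensive.

Import Order.TTheory.
Local Open Scope classical_set_scope.
Local Open Scope order_scope.
Local Obligation Tactic := idtac.

Record signature := Signature {
  symbol :> Type;
  arity : symbol -> nat
}.

Record algebra (S : signature) := Algebra {
  carrier :> Type;
  op : forall f : S, ('I_(arity f) -> carrier) -> carrier
}.

Record hom (S : signature) (A B : algebra S) := Hom {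
  hom_fun :> A -> B;
  hom_op : forall (f : S) (x : 'I_(arity f) -> A),
    hom_fun (op x) = op (fun k => hom_fun (x k))
}.

Record subuniverse (S : signature) (A : algebra S) := Subuniverse {
  sub_set :> set A;
  sub_op : forall (f : S) (x : 'I_(arity f) -> A),
    (forall k, sub_set (x k)) -> sub_set (op x)
}.

Definition subalgebra (S : signature) (A : algebra S) (U : subuniverse A) :
    algebra S :=
  @Algebra S {x : A | sub_set U x}
    (fun f x => exist _ _ (sub_op (fun k => svalP (x k)))).

Definition power (S : signature) (A : algebra S) (I : Type) : algebra S :=
  @Algebra S (I -> A) (fun f x i => op (fun k => x k i)).

Definition SP (S : signature) (A B : algebra S) : Prop :=
  exists (I : Type) (U : subuniverse (power A I)), B = subalgebra U.

Record con (S : signature) (A : algebra S) := Con {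
  con_rel : set (A * A);
  con_refl : forall a, con_rel (a, a);
  con_sym : forall a b, con_rel (a, b) -> con_rel (b, a);
  con_trans : forall a b c,
    con_rel (a, b) -> con_rel (b, c) -> con_rel (a, c);
  con_op : forall (f : S) (x y : 'I_(arity f) -> A),
    (forall k, con_rel (x k, y k)) -> con_rel (op x, op y)
}.

Lemma con_eqP (S : signature) (A : algebra S) (t u : con A) :
  con_rel t = con_rel u -> t = u.
Proof.
case: t u => [t t1 t2 t3 t4] [u u1 u2 u3 u4] /= E; subst u.
by congr Con; exact: Prop_irrelevance.
Qed.

HB.instance Definition _ (S : signature) (A : algebra S) :=
  gen_eqMixin (con A).
HB.instance Definition _ (S : signature) (A : algebra S) :=
  gen_choiceMixin (con A).

Fact con_display : Order.disp_t. Proof. exact: Order.Disp tt tt. Qed.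

Section ConLattice.
Variables (S : signature) (A : algebra S).
Implicit Types t u v : con A.

Definition con_le t u : bool := `[< con_rel t `<=` con_rel u >].

Lemma con_leP t u : reflect (con_rel t `<=` con_rel u) (con_le t u).
Proof. exact: asboolP. Qed.

Lemma con_le_refl : reflexive con_le.
Proof. by move=> t; apply/con_leP. Qed.

Lemma con_le_anti : antisymmetric con_le.
Proof.
by move=> t u /andP[/con_leP tu /con_leP ut]; apply: con_eqP; apply/seteqP.
Qed.

Lemma con_le_trans : transitive con_le.
Proof.
move=> u t v /con_leP tu /con_leP uv; apply/con_leP.
exact: subset_trans tu uv.
Qed.

HB.instance Definition _ := Order.Le_isPOrder.Build con_display (con A)
  con_le_refl con_le_anti con_le_trans.

(* The intersection of a family of congruences; the join of t and u is the
   intersection of all congruences containing both. *)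
Program Definition con_inf (F : set (con A)) : con A :=
  @Con S A [set p | forall t, F t -> con_rel t p] _ _ _ _.
Next Obligation. by move=> F a t _; exact: con_refl. Qed.
Next Obligation. by move=> F a b ab t Ft; apply/con_sym/ab. Qed.
Next Obligation.
by move=> F a b c ab bc t Ft; exact: con_trans (ab t Ft) (bc t Ft).
Qed.
Next Obligation. by move=> F f x y xy t Ft; apply: con_op => k; exact: xy. Qed.

Definition con_meet t u : con A := con_inf [set v | v = t \/ v = u].
Definition con_join t u : con A :=
  con_inf [set v | con_rel t `|` con_rel u `<=` con_rel v].

Lemma con_meetP v t u : (v <= con_meet t u) = (v <= t) && (v <= u).
Proof.
apply/con_leP/andP => [vtu|[/con_leP vt /con_leP vu] p vp w /=].
  by split; apply/con_leP => p /vtu; apply; [left|right].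
by move=> [->|->]; [exact: vt|exact: vu].
Qed.

Lemma con_joinP t u v : (con_join t u <= v) = (t <= v) && (u <= v).
Proof.
apply/con_leP/andP => [tuv|[/con_leP tv /con_leP uv] p]; last first.
  by apply => /=; rewrite subUset.
by split; apply/con_leP => p h; apply: tuv => w /=; apply; [left|right].
Qed.

HB.instance Definition _ :=
  Order.POrder_MeetJoin_isLattice.Build con_display (con A)
    con_meetP con_joinP.

Program Definition con0 : con A := @Con S A [set p | p.1 = p.2] _ _ _ _.
Next Obligation. by []. Qed.
Next Obligation. by []. Qed.
Next Obligation. by move=> a b c /= ->. Qed.
Next Obligation. by move=> f x y /= xy; congr op; apply/funext. Qed.

Lemma con0_le t : con0 <= t.
Proof. by apply/con_leP => -[a b] /= ->; exact: con_refl. Qed.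

HB.instance Definition _ :=
  Order.hasBottom.Build con_display (con A) con0_le.

End ConLattice.

Definition permute (S : signature) (A : algebra S) (t u : con A) : Prop :=
  (con_rel t \; con_rel u = con_rel u \; con_rel t)%relation.

Program Definition con_preim (S : signature) (A B : algebra S) (h : hom A B)
    (t : con B) : con A :=
  @Con S A [set p | con_rel t (h p.1, h p.2)] _ _ _ _.
Next Obligation. by move=> *; exact: con_refl. Qed.
Next Obligation. by move=> S A B h t a b; exact: con_sym. Qed.
Next Obligation. by move=> S A B h t a b c; exact: con_trans. Qed.
Next Obligation. by move=> S A B h t f x y xy /=; rewrite !hom_op; exact: con_op. Qed.

Definition kernel (S : signature) (A B : algebra S) (h : hom A B) : con A :=
  con_preim h \bot.

Section CongruenceAlgebra.
Variables (S : signature) (A : algebra S) (g : con A).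

Program Definition con_subuniverse : subuniverse (power A 'I_2) :=
  @Subuniverse S (power A 'I_2) [set a | con_rel g (a ord0, a ord_max)] _.
Next Obligation. by move=> f x xg; exact: con_op. Qed.

Definition con_algebra : algebra S := subalgebra con_subuniverse.

Definition proj (i : 'I_2) : hom con_algebra A :=
  @Hom S con_algebra A (fun a => sval a i) (fun f x => erefl).

Definition con_lift (t : con A) (i : 'I_2) : con con_algebra :=
  con_preim (proj i) t.

Definition eta (i : 'I_2) : con con_algebra := kernel (proj i).

End CongruenceAlgebra.

Section Reach.
Variables (T : eqType) (up : T -> seq T).
Fixpoint reach (n : nat) (x y : T) : bool :=
  (x == y) || (if n is m.+1 then has (fun z => reach m z y) (up x) else false).
End Reach.

Variant M3 := M3_0 | M3_a | M3_b | M3_c | M3_1.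

Definition M3_nat (x : M3) : nat :=
  match x with M3_0 => 0 | M3_a => 1 | M3_b => 2 | M3_c => 3 | M3_1 => 4 end.
Definition nat_M3 (n : nat) : M3 :=
  match n with 0 => M3_0 | 1 => M3_a | 2 => M3_b | 3 => M3_c | _ => M3_1 end.
Lemma M3_natK : cancel M3_nat nat_M3. Proof. by case. Qed.
HB.instance Definition _ := Countable.copy M3 (can_type M3_natK).

Definition M3_up (x : M3) : seq M3 :=
  match x with
  | M3_0 => [:: M3_a; M3_b; M3_c]
  | M3_a | M3_b | M3_c => [:: M3_1]
  | M3_1 => [::]
  end.

(* The longest chain of covers has length 2. *)
Definition M3_le : rel M3 := reach M3_up 2.

Definition M3_meet (x y : M3) : M3 :=
  if M3_le x y then x else if M3_le y x then y else M3_0.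
Definition M3_join (x y : M3) : M3 :=
  if M3_le x y then y else if M3_le y x then x else M3_1.

Fact M3_display : Order.disp_t. Proof. exact: Order.Disp tt tt. Qed.

Lemma M3_le_refl : reflexive M3_le. Proof. by case. Qed.
Lemma M3_le_anti : antisymmetric M3_le. Proof. by case; case. Qed.
Lemma M3_le_trans : transitive M3_le. Proof. by case; case; case. Qed.
HB.instance Definition _ := Order.Le_isPOrder.Build M3_display M3
  M3_le_refl M3_le_anti M3_le_trans.

Lemma M3_meetP (x y z : M3) : (x <= M3_meet y z) = (x <= y) && (x <= z).
Proof. by case: x y z; case; case. Qed.
Lemma M3_joinP (x y z : M3) : (M3_join x y <= z) = (x <= z) && (y <= z).
Proof. by case: x y z; case; case. Qed.
HB.instance Definition _ :=
  Order.POrder_MeetJoin_isLattice.Build M3_display M3 M3_meetP M3_joinP.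

Variant M33 := M33_0 | M33_x | M33_y | M33_z | M33_a | M33_b | M33_c | M33_1.

Definition M33_nat (x : M33) : nat :=
  match x with
  | M33_0 => 0 | M33_x => 1 | M33_y => 2 | M33_z => 3
  | M33_a => 4 | M33_b => 5 | M33_c => 6 | M33_1 => 7
  end.
Definition nat_M33 (n : nat) : M33 :=
  match n with
  | 0 => M33_0 | 1 => M33_x | 2 => M33_y | 3 => M33_z
  | 4 => M33_a | 5 => M33_b | 6 => M33_c | _ => M33_1
  end.
Lemma M33_natK : cancel M33_nat nat_M33. Proof. by case. Qed.
HB.instance Definition _ := Countable.copy M33 (can_type M33_natK).

Definition M33_up (x : M33) : seq M33 :=
  match x with
  | M33_0 => [:: M33_x; M33_y; M33_z]
  | M33_x | M33_y => [:: M33_a]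
  | M33_z => [:: M33_a; M33_b; M33_c]
  | M33_a | M33_b | M33_c => [:: M33_1]
  | M33_1 => [::]
  end.

(* The longest chain of covers has length 3. *)
Definition M33_le : rel M33 := reach M33_up 3.

Definition M33_meet (x y : M33) : M33 :=
  if M33_le x y then x else if M33_le y x then y else
  if M33_le M33_z x && M33_le M33_z y then M33_z else M33_0.
Definition M33_join (x y : M33) : M33 :=
  if M33_le x y then y else if M33_le y x then x else
  if M33_le x M33_a && M33_le y M33_a then M33_a else M33_1.

Fact M33_display : Order.disp_t. Proof. exact: Order.Disp tt tt. Qed.

Lemma M33_le_refl : reflexive M33_le. Proof. by case. Qed.
Lemma M33_le_anti : antisymmetric M33_le. Proof. by case; case. Qed.
Lemma M33_le_trans : transitive M33_le. Proof. by case; case; case. Qed.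
HB.instance Definition _ := Order.Le_isPOrder.Build M33_display M33
  M33_le_refl M33_le_anti M33_le_trans.

Lemma M33_meetP (x y z : M33) : (x <= M33_meet y z) = (x <= y) && (x <= z).
Proof. by case: x y z; case; case. Qed.
Lemma M33_joinP (x y z : M33) : (M33_join x y <= z) = (x <= z) && (y <= z).
Proof. by case: x y z; case; case. Qed.
HB.instance Definition _ :=
  Order.POrder_MeetJoin_isLattice.Build M33_display M33 M33_meetP M33_joinP.

Definition sublattice (d : Order.disp_t) (L : latticeType d) (U : set L) :
    Prop :=
  forall x y, U x -> U y -> U (x `&` y) /\ U (x `|` y).

(* Main.v *)
(** Permutability turns every join of the [M3] into a relational composite, so
    elements of [con_algebra gamma] realizing the joins in its congruence
    lattice can be built coordinatewise: if [a0 delta b1], then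
    [a0 gamma c1 alpha b1] for some [c1], and [(a0, c1)] is a pair of [gamma].
    Disjointness of the atoms gives the meets.  The lattice facts involving
    only the three atoms and only the three coatoms of [M33] then determine
    all the others. *)
From HB Require Import structures.
Require Import Defs.
From mathcomp Require Import all_boot all_order.
From mathcomp Require Import boolp classical_sets.

Set Implicit Arguments.
Unset Strict Implicit.
Unset Printing Implicit Defensive.

Import Order.TTheory.

Section Congruences.
Local Open Scope classical_set_scope.
Local Open Scope order_scope.

(** * Joins of permuting congruences as relational composites *)

Section PermutingCongruences.
Context {S : signature} {A : algebra S}.
Implicit Types t u v : con A.

Lemma con_rel_meet t u (p : A * A) :
  con_rel (t `&` u) p <-> con_rel t p /\ con_rel u p.
Proof.
change (con_rel (t `&` u) p) with (forall v, v = t \/ v = u -> con_rel v p).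
by split=> [tup|[tp up] v [->|->] //]; split; apply: tup; [left | right].
Qed.

Lemma permute_comp t u a b c : permute t u ->
  con_rel t (a, c) -> con_rel u (c, b) ->
  exists2 d, con_rel u (a, d) & con_rel t (d, b).
Proof.
move=> /(congr1 (fun R => R (a, b))) /= tu uac tcb.
by rewrite tu; exists c.
Qed.

Lemma con_meet_bot t u a b : t `&` u = \bot ->
  con_rel t (a, b) -> con_rel u (a, b) -> a = b.
Proof.
move=> tu tab uab; suff : con_rel (\bot : con A) (a, b) by [].
by rewrite -tu; exact/con_rel_meet.
Qed.

Lemma con_rel_le t u p : t <= u -> con_rel t p -> con_rel u p.
Proof. by move/con_leP; apply. Qed.

Lemma con_rel_joinW t u a b c :
  con_rel t (a, c) -> con_rel u (c, b) -> con_rel (t `|` u) (a, b).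
Proof.
move=> tac ucb.
exact: con_trans (con_rel_le (leUl t u) tac) (con_rel_le (leUr u t) ucb).
Qed.

(** Permutability makes the composite symmetric and transitive, hence a congruence. It contains both
    factors and lies in every congruence that does. *)
Lemma con_rel_join t u a b : permute t u ->
  con_rel (t `|` u) (a, b) <-> exists2 c, con_rel t (a, c) & con_rel u (c, b).
Proof.
move=> tu; have ut : permute u t by rewrite /permute tu.
pose R := [set p | exists2 c, con_rel t (p.1, c) & con_rel u (c, p.2)].
have R_refl x : R (x, x) by exists x; exact: con_refl.
have R_sym x y : R (x, y) -> R (y, x).
  by case=> z /con_sym tzx /con_sym uyz; exact: permute_comp ut uyz tzx.
have R_trans x y z : R (x, y) -> R (y, z) -> R (x, z).
  case=> c /= txc ucy [d /= tyd udz].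
  have [e tce ued] := permute_comp ut ucy tyd.
  by exists e; [exact: con_trans txc tce | exact: con_trans ued udz].
have R_op (f : S) (x y : 'I_(arity f) -> A) :
    (forall k, R (x k, y k)) -> R (op x, op y).
  (* Compatibility with [f] needs the intermediate elements for all arguments as one tuple. *)
  move=> xy; have /choice[z xzy] : forall k, exists c,
      con_rel t (x k, c) /\ con_rel u (c, y k).
    by move=> k; have [c xc cy] := xy k; exists c.
  by exists (op z); apply: con_op => k; case: (xzy k).
have joinE q : con_rel (t `|` u) q =
    (forall v, con_rel t `|` con_rel u `<=` con_rel v -> con_rel v q) by [].
rewrite joinE; split.
  move/(_ (Con R_refl R_sym R_trans R_op)); apply => -[x y] /=.
  by case=> xy; [exists y => //; exact: con_refl
                |exists x => //; exact: con_refl].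
by case=> c; exact: con_rel_joinW.
Qed.

(** A single interpolation yields both conclusions: the composite fills the upper bound [v], so it
    is the join, and it inherits the symmetry of [v]. *)
Lemma permute_join v t u : t <= v -> u <= v ->
  (forall a b, con_rel v (a, b) ->
     exists2 c, con_rel t (a, c) & con_rel u (c, b)) ->
  t `|` u = v /\ permute t u.
Proof.
move=> tv uv vtu; split.
  apply/le_anti/andP; split; first by rewrite leUx tv.
  by apply/con_leP => -[a b] /vtu[c]; exact: con_rel_joinW.
apply/seteqP; split=> -[a b] [c /= ac cb].
  by apply: vtu; apply: con_trans (con_rel_le uv ac) (con_rel_le tv cb).
(* The other inclusion interpolates the reversed pair. *)
have /vtu[d bd da] : con_rel v (b, a).
  by apply: con_sym; apply: con_trans (con_rel_le tv ac) (con_rel_le uv cb).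
by exists d; exact: con_sym.
Qed.

Lemma permute_sym t u : permute t u -> permute u t.
Proof. by rewrite /permute => ->. Qed.

Lemma permute_le t u : t <= u -> permute t u.
Proof.
move=> tu; apply: (proj2 (permute_join tu (lexx u) _)) => a b uab.
by exists a => //; exact: con_refl.
Qed.

(* The congruence [z] is inserted between [t] and [u] because
   [t ∨ u = (t ∨ z) ∨ u = (t ∘ z) ∘ u = t ∘ (z ∘ u)]. *)
Lemma permute_join_le z t u :
  z <= u -> permute t z -> permute (t `|` z) u -> permute t u.
Proof.
move=> zu tz tzu.
apply: (proj2 (permute_join (leUl t u) (leUr u t) _)) => a b tub.
have: con_rel ((t `|` z) `|` u) (a, b).
  by rewrite -joinA (join_r zu).
case/(con_rel_join _ _ tzu) => c /(con_rel_join _ _ tz)[d tad zdc] ucb.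
by exists d => //; exact: con_trans (con_rel_le zu zdc) ucb.
Qed.

End PermutingCongruences.

(** * Homomorphisms from [M33] into a lattice *)

Section LatticeM33.
Context {d : Order.disp_t} {L : latticeType d}.

(** The equations imply the images of all covering relations, so [g] is monotone and comparable
    pairs are settled. Of the ten incomparable pairs, six are hypotheses and four combine [M33_x] or
    [M33_y] with [M33_b] or [M33_c]. *)
Lemma M33_lmorphism (g : M33 -> L) :
    [/\ g M33_x `&` g M33_y = g M33_0, g M33_x `&` g M33_z = g M33_0 &
        g M33_y `&` g M33_z = g M33_0] ->
    [/\ g M33_x `|` g M33_y = g M33_a, g M33_x `|` g M33_z = g M33_a &
        g M33_y `|` g M33_z = g M33_a] ->
    [/\ g M33_a `&` g M33_b = g M33_z, g M33_a `&` g M33_c = g M33_z &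
        g M33_b `&` g M33_c = g M33_z] ->
    [/\ g M33_a `|` g M33_b = g M33_1, g M33_a `|` g M33_c = g M33_1 &
        g M33_b `|` g M33_c = g M33_1] ->
  exists g' : {lmorphism M33 -> L}, g' =1 g.
Proof.
move=> [Ixy Ixz Iyz] [Uxy Uxz Uyz] [Iab Iac Ibc] [Uab Uac Ubc].
have l0x : g M33_0 <= g M33_x by rewrite -Ixy leIl.
have l0y : g M33_0 <= g M33_y by rewrite -Ixy leIr.
have l0z : g M33_0 <= g M33_z by rewrite -Iyz leIr.
have lxa : g M33_x <= g M33_a by rewrite -Uxy leUl.
have lya : g M33_y <= g M33_a by rewrite -Uxy leUr.
have lza : g M33_z <= g M33_a by rewrite -Uyz leUr.
have lzb : g M33_z <= g M33_b by rewrite -Iab leIr.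
have lzc : g M33_z <= g M33_c by rewrite -Iac leIr.
have la1 : g M33_a <= g M33_1 by rewrite -Uab leUl.
have lb1 : g M33_b <= g M33_1 by rewrite -Uab leUr.
have lc1 : g M33_c <= g M33_1 by rewrite -Uac leUr.
(* Mixed meets: x ∧ b = (x ∧ a) ∧ b = x ∧ (a ∧ b) = x ∧ z. *)
have Ixb : g M33_x `&` g M33_b = g M33_0 by rewrite -(meet_l lxa) -meetA Iab.
have Ixc : g M33_x `&` g M33_c = g M33_0 by rewrite -(meet_l lxa) -meetA Iac.
have Iyb : g M33_y `&` g M33_b = g M33_0 by rewrite -(meet_l lya) -meetA Iab.
have Iyc : g M33_y `&` g M33_c = g M33_0 by rewrite -(meet_l lya) -meetA Iac.
(* Mixed joins: x ∨ b = x ∨ (z ∨ b) = (x ∨ z) ∨ b = a ∨ b. *)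
have Uxb : g M33_x `|` g M33_b = g M33_1 by rewrite -(join_r lzb) joinA Uxz.
have Uxc : g M33_x `|` g M33_c = g M33_1 by rewrite -(join_r lzc) joinA Uxz.
have Uyb : g M33_y `|` g M33_b = g M33_1 by rewrite -(join_r lzb) joinA Uyz.
have Uyc : g M33_y `|` g M33_c = g M33_1 by rewrite -(join_r lzc) joinA Uyz.
have gle : {homo g : u v / u <= v}.
  have l0a := le_trans l0x lxa; have l0b := le_trans l0z lzb.
  have l0c := le_trans l0z lzc; have l01 := le_trans l0a la1.
  have lx1 := le_trans lxa la1; have ly1 := le_trans lya la1.
  have lz1 := le_trans lza la1.
  by case=> [] [].
have gI : {morph g : u v / u `&` v}.
  move=> u v; case: (boolP (u <= v)) => [uv|nuv].
    by rewrite (meet_l uv) (meet_l (gle _ _ uv)).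
  case: (boolP (v <= u)) => [vu|nvu].
    by rewrite (meet_r vu) (meet_r (gle _ _ vu)).
  case: u v nuv nvu => [] [] // _ _; apply/esym;
    first [by [] | by rewrite meetC].
have gU : {morph g : u v / u `|` v}.
  move=> u v; case: (boolP (u <= v)) => [uv|nuv].
    by rewrite (join_r uv) (join_r (gle _ _ uv)).
  case: (boolP (v <= u)) => [vu|nvu].
    by rewrite (join_l vu) (join_l (gle _ _ vu)).
  case: u v nuv nvu => [] [] // _ _; apply/esym;
    first [by [] | by rewrite joinC].
pose gO := Order.isOrderMorphism.Build _ _ _ _ g gle.
pose gM := Order.isMeetLatticeMorphism.Build _ _ _ _ g gI.
pose gJ := Order.isJoinLatticeMorphism.Build _ _ _ _ g gU.
pose G : {lmorphism M33 -> L} := HB.pack g gO gM gJ.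
by exists G.
Qed.

(* Every nontrivial congruence of [M33] collapses the prime quotient
   [M33_a / M33_z]: the search below finds, for each [u != v], a unary
   polynomial sending [{u, v}] to [{M33_z, M33_a}]. *)
Lemma M33_lmorphism_inj (g : {lmorphism M33 -> L}) :
  g M33_z <> g M33_a -> injective g.
Proof.
move=> gza u v guv; apply: contrapT => /eqP nuv; apply: gza.
pose s := [:: M33_0; M33_x; M33_y; M33_z; M33_a; M33_b; M33_c; M33_1].
pose pol (p q r w : M33) : M33 := (((w `|` p) `&` q) `|` r) `&` M33_a.
have : has (fun p => has (fun q => has (fun r =>
    perm_eq [:: pol p q r u; pol p q r v] [:: M33_z; M33_a]) s) s) s.
  by case: u v {guv} nuv => [] [].
case/hasP=> p _ /hasP[q _ /hasP[r _ E]].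
have gpol : g (pol p q r u) = g (pol p q r v).
  have gI (w w' : M33) : g (w `&` w') = g w `&` g w' := omorphI g w w'.
  have gU (w w' : M33) : g (w `|` w') = g w `|` g w' := omorphU g w w'.
  by rewrite /pol !(gI, gU) guv.
by move: E gpol; case: (pol _ _ _ u) (pol _ _ _ v) => [] [].
Qed.

Lemma sublattice_range {d'} {L' : latticeType d'} (g : {lmorphism L' -> L}) :
  sublattice (range g).
Proof.
move=> _ _ [u _ <-] [v _ <-].
by split; [exists (u `&` v); rewrite // omorphI
          |exists (u `|` v); rewrite // omorphU].
Qed.

End LatticeM33.

(** Comparable congruences always permute. For a mixed pair such as x, b, the atom z lies below b
    and x ∨ z = a, so permutability follows from that of x, z and of a, b. *)
Lemma M33_permute {S : signature} {A : algebra S}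
    (g : {lmorphism M33 -> con A}) :
    [/\ permute (g M33_x) (g M33_y), permute (g M33_x) (g M33_z) &
        permute (g M33_y) (g M33_z)] ->
    [/\ permute (g M33_a) (g M33_b), permute (g M33_a) (g M33_c) &
        permute (g M33_b) (g M33_c)] ->
  forall u v, permute (g u) (g v).
Proof.
move=> [Pxy Pxz Pyz] [Pab Pac Pbc].
have P w v : M33_z <= v -> w `|` M33_z = M33_a ->
    permute (g w) (g M33_z) -> permute (g M33_a) (g v) -> permute (g w) (g v).
  move=> zv wza Pwz Pav; apply: (permute_join_le (z := g M33_z)) => //.
    exact: omorph_le.
  by rewrite -omorphU wza.
have Pxb : permute (g M33_x) (g M33_b) by exact: P.
have Pxc : permute (g M33_x) (g M33_c) by exact: P.
have Pyb : permute (g M33_y) (g M33_b) by exact: P.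
have Pyc : permute (g M33_y) (g M33_c) by exact: P.
move=> u v; case: (boolP (u <= v)) => [uv|nuv].
  exact/permute_le/omorph_le.
case: (boolP (v <= u)) => [vu|nvu].
  exact/permute_sym/permute_le/omorph_le.
case: u v nuv nvu => [] [] // _ _; first [by [] | exact: permute_sym].
Qed.

(** * Meets, joins and permutability in the congruence lattice of [con_algebra g] *)

Section CongruenceAlgebra.
Context {S : signature} {A : algebra S} {g : con A}.
Implicit Types (s t u : con A) (a b : con_algebra g).

Lemma con_algebra_rel a : con_rel g (sval a ord0, sval a ord_max).
Proof. exact: svalP a. Qed.

Lemma con_algebra_ext a b :
  sval a ord0 = sval b ord0 -> sval a ord_max = sval b ord_max -> a = b.
Proof.
case: a b => [a ga] [b gb] /= ab0 ab1; apply: eq_exist; apply/funext => i.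
case: (unliftP ord0 i) => [j ->|-> //]; rewrite ord1.
by have -> : lift ord0 ord0 = ord_max :> 'I_2 by exact: val_inj.
Qed.

Lemma con_algebra_pair (x y : A) : con_rel g (x, y) ->
  exists a : con_algebra g, sval a ord0 = x /\ sval a ord_max = y.
Proof.
move=> gxy.
by exists (exist _ (fun i : 'I_2 => if i == ord0 then x else y) gxy).
Qed.

(** Order is reflected because [g] is reflexive: the diagonal embeds [A] into [con_algebra g]. *)
Lemma con_lift_le t u i : (con_lift g t i <= con_lift g u i) = (t <= u).
Proof.
apply/con_leP/con_leP => tu; last by move=> p; exact: tu.
move=> [x y] txy.
pose diag z : con_algebra g := exist _ (fun=> z) (con_refl g z).
exact: (tu (diag x, diag y)).
Qed.

Lemma con_lift_meet t u i :
  con_lift g (t `&` u) i = con_lift g t i `&` con_lift g u i.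
Proof.
apply: con_eqP; apply/seteqP; split=> p.
  by move/con_rel_meet => tup; apply/con_rel_meet.
by move/con_rel_meet => tup; apply/con_rel_meet.
Qed.

Lemma con_lift_join t u i : permute t u ->
  con_lift g t i `|` con_lift g u i = con_lift g (t `|` u) i /\
  permute (con_lift g t i) (con_lift g u i).
Proof.
move=> tu; apply: permute_join; rewrite ?con_lift_le ?leUl ?leUr// => a b.
case/(con_rel_join _ _ tu) => z taz uzb.
(* Only coordinate [i] matters, so a diagonal pair serves as interpolant. *)
by exists (exist _ (fun=> z) (con_refl g z)).
Qed.

(** The second coordinates are related by [t] and [u], hence equal. The first coordinates are then
    [g]-related through this common value, and [t]-related as well. *)
Lemma lift_meet_bot t u : t `&` g = \bot -> t `&` u = \bot ->
  (con_lift g t ord0 `&` con_lift g t ord_max) `&`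
    (con_lift g t ord0 `&` con_lift g u ord_max) = \bot.
Proof.
move=> tg tu; apply/eqP; rewrite -lex0; apply/con_leP => -[a b].
case/con_rel_meet => /con_rel_meet[t0 t1] /con_rel_meet[_ u1].
have ab1 : sval a ord_max = sval b ord_max := con_meet_bot tu t1 u1.
apply: con_algebra_ext => //; apply: (con_meet_bot tg t0).
apply: (con_trans (con_algebra_rel a)); rewrite ab1.
exact/con_sym/con_algebra_rel.
Qed.

(** Here the first coordinates agree, so the second ones are [g]-related through them. *)
Lemma lift_meet_eta t u : u `&` g = \bot ->
  (con_lift g t ord0 `&` con_lift g u ord_max) `&` eta g ord0 = \bot.
Proof.
move=> ug; apply/eqP; rewrite -lex0; apply/con_leP => -[a b].
case/con_rel_meet => /con_rel_meet[_ u1] /= ab0.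
apply: con_algebra_ext => //; apply: (con_meet_bot ug u1).
apply: (con_trans (con_sym (con_algebra_rel a))); rewrite ab0.
exact: con_algebra_rel.
Qed.

Lemma lift_join_eta t u : permute g u -> t <= g `|` u ->
  (con_lift g t ord0 `&` con_lift g u ord_max) `|` eta g ord0 =
    con_lift g t ord0 /\
  permute (con_lift g t ord0 `&` con_lift g u ord_max) (eta g ord0).
Proof.
(* The interpolant will share its first coordinate with [a], so [eta] must be the first factor. *)
move=> gu tgu; rewrite joinC.
suff [-> /permute_sym] : eta g ord0 `|`
    (con_lift g t ord0 `&` con_lift g u ord_max) = con_lift g t ord0 /\
  permute (eta g ord0) (con_lift g t ord0 `&` con_lift g u ord_max) by [].
apply: permute_join; [by rewrite con_lift_le le0x | exact: leIl |].
move=> a b tab.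
(* From a0 t b0 g b1 one gets a0 g z u b1, and the interpolant is (a0, z). *)
have /(con_rel_join _ _ gu)[z gaz uzb] :
    con_rel (g `|` u) (sval a ord0, sval b ord_max).
  apply: con_trans (con_rel_le tgu tab) _.
  exact: con_rel_le (leUl g u) (con_algebra_rel b).
have [c [c0 c1]] := con_algebra_pair gaz.
exists c; first by rewrite /= c0.
by apply/con_rel_meet; split; rewrite /= ?c0 ?c1.
Qed.

(** The interpolant (x, y) is found second coordinate first: a1 t y u b1, and then y g x t b0. Since
    a0 t b0, also a0 t x. *)
Lemma lift_join_lift t u : permute t u -> permute g t ->
    g <= t `|` u -> u <= g `|` t ->
  (con_lift g t ord0 `&` con_lift g t ord_max) `|`
    (con_lift g t ord0 `&` con_lift g u ord_max) = con_lift g t ord0 /\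
  permute (con_lift g t ord0 `&` con_lift g t ord_max)
    (con_lift g t ord0 `&` con_lift g u ord_max).
Proof.
move=> tu gt gtu ugt; apply: permute_join; [exact: leIl | exact: leIl |].
move=> a b t0; have ga := con_algebra_rel a; have gb := con_algebra_rel b.
have /(con_rel_join _ _ tu)[y tay uyb] :
    con_rel (t `|` u) (sval a ord_max, sval b ord_max).
  apply: con_trans (con_rel_le gtu (con_sym ga)) _.
  exact: con_trans (con_rel_le (leUl t u) t0) (con_rel_le gtu gb).
have /(con_rel_join _ _ gt)[x gyx txb] : con_rel (g `|` t) (y, sval b ord0).
  apply: con_trans (con_rel_le ugt uyb) _.
  exact: con_rel_le (leUl g t) (con_sym gb).
have [c [c0 c1]] := con_algebra_pair (con_sym gyx).
exists c; apply/con_rel_meet; split; rewrite /= ?c0 ?c1 //.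
exact: (@con_trans _ _ t _ (sval b ord0)) t0 (con_sym txb).
Qed.

End CongruenceAlgebra.
End Congruences.

(** * The copy of [M33] generated from the given [M3] *)

Theorem theorem1p3 (S : signature) (A : algebra S)
    (alpha beta gamma delta : con A)
    (h : {lmorphism M3 -> con A}) (h_inj : injective h)
    (h_bot : h M3_0 = (\bot)%O)
    (h_alpha : h M3_a = alpha) (h_beta : h M3_b = beta)
    (h_gamma : h M3_c = gamma) (h_delta : h M3_1 = delta)
    (h_perm : forall u v : M3, permute (h u) (h v)) :
  let eta0 := eta gamma ord0 in
  let alpha0 := con_lift gamma alpha ord0 in
  let alpha1 := con_lift gamma alpha ord_max in
  let beta0 := con_lift gamma beta ord0 in
  let beta1 := con_lift gamma beta ord_max in
  let gamma0 := con_lift gamma gamma ord0 in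
  let delta0 := con_lift gamma delta ord0 in
  let U : set (con (con_algebra gamma)) :=
    [set (\bot)%O; eta0; (alpha0 `&` alpha1)%O; (alpha0 `&` beta1)%O;
         alpha0; beta0; gamma0; delta0]%classic in
  SP A (con_algebra gamma) /\
  sublattice U /\
  (exists2 g : {lmorphism M33 -> con (con_algebra gamma)},
     injective g /\ range g = U &
     [/\ g M33_0 = (\bot)%O, g M33_1 = delta0,
         [/\ g M33_x = (alpha0 `&` alpha1)%O,
             g M33_y = (alpha0 `&` beta1)%O & g M33_z = eta0] &
         [/\ g M33_a = alpha0, g M33_b = beta0 & g M33_c = gamma0]]) /\
  (forall t u, U t -> U u -> permute t u).
Proof.
subst alpha beta gamma delta => eta0 alpha0 alpha1 beta0 beta1 gamma0 delta0 U.
have hI u v : h (u `&` v)%O = (h u `&` h v)%O := omorphI h u v.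
have hU u v : h (u `|` v)%O = (h u `|` h v)%O := omorphU h u v.
(* By definition [eta0] is the lift of the bottom congruence [h M3_0], so lifting along coordinate 0
   carries the given [M3] onto the part of [M33] above [M33_z]. *)
have lift_I u v : (u `&` v)%O = M3_0 ->
    (con_lift (h M3_c) (h u) ord0 `&` con_lift (h M3_c) (h v) ord0)%O = eta0.
  by move=> uv; rewrite -con_lift_meet -hI uv h_bot.
have lift_U u v : (u `|` v)%O = M3_1 ->
    (con_lift (h M3_c) (h u) ord0 `|` con_lift (h M3_c) (h v) ord0)%O =
      delta0 /\
    permute (con_lift (h M3_c) (h u) ord0) (con_lift (h M3_c) (h v) ord0).
  by move=> uv; rewrite /delta0 -uv hU; exact: con_lift_join.
(* Here and in the next two joins, each required inequality is the image under [h] of one that holds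
   in [M3]. *)
have [Uxy Pxy] : ((alpha0 `&` alpha1) `|` (alpha0 `&` beta1))%O = alpha0 /\
    permute (alpha0 `&` alpha1)%O (alpha0 `&` beta1)%O.
  by apply: lift_join_lift; rewrite // -hU; apply: omorph_le.
have [Uxz Pxz] : ((alpha0 `&` alpha1) `|` eta0)%O = alpha0 /\
    permute (alpha0 `&` alpha1)%O eta0.
  by apply: lift_join_eta; rewrite // -hU; apply: omorph_le.
have [Uyz Pyz] : ((alpha0 `&` beta1) `|` eta0)%O = alpha0 /\
    permute (alpha0 `&` beta1)%O eta0.
  by apply: lift_join_eta; rewrite // -hU; apply: omorph_le.
have [Uab Pab] := lift_U M3_a M3_b erefl.
have [Uac Pac] := lift_U M3_a M3_c erefl.
have [Ubc Pbc] := lift_U M3_b M3_c erefl.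
pose g0 u := match u with
  | M33_0 => (\bot)%O
  | M33_x => (alpha0 `&` alpha1)%O
  | M33_y => (alpha0 `&` beta1)%O
  | M33_z => eta0
  | M33_a => alpha0 | M33_b => beta0 | M33_c => gamma0
  | M33_1 => delta0
  end.
have [] := @M33_lmorphism _ _ g0.
- split; rewrite /g0.
  + by apply: lift_meet_bot; rewrite -hI h_bot.
  + by apply: lift_meet_eta; rewrite -hI h_bot.
  + by apply: lift_meet_eta; rewrite -hI h_bot.
- by [].
- by split; apply: lift_I.
- by [].
move=> g gE.
have rangeU : range g = U.
  apply/seteqP; split=> t.
    by case=> u _ <-; rewrite gE /U /=; case: u => /=; tauto.
  rewrite /U /=.
  (* The witnesses follow the order in which [U] lists its elements. *)
  by case=> [[[[[[[->|->]|->]|->]|->]|->]|->]|->];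
    [exists M33_0 | exists M33_z | exists M33_x | exists M33_y
    | exists M33_a | exists M33_b | exists M33_c | exists M33_1];
    rewrite ?gE.
split; first by exists 'I_2, (con_subuniverse (h M3_c)).
split; first by rewrite -rangeU; exact: sublattice_range.
split.
  exists g; last by rewrite !gE.
  (* It remains to separate [eta0] from [alpha0]. Since lifting reflects order, their equality would
     force [h M3_a] to be the bottom [h M3_0], against the injectivity of [h]. *)
  split=> //; apply: M33_lmorphism_inj; rewrite !gE /= => eta_alpha.
  have : M3_0 = M3_a; last by [].
  apply: h_inj; apply/le_anti; rewrite omorph_le //= h_bot.
  by rewrite -(con_lift_le (g := h M3_c) _ _ ord0) -/alpha0 -eta_alpha.
rewrite -rangeU => _ _ [u _ <-] [v _ <-].
by apply: M33_permute; rewrite !gE.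
Qed.
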